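(* Let $h,k,\mu$ be pairwise relatively prime odd positive integers with $h,k\ge 3$. Let $\alpha$ be either $0$ or a positive integer with $(\alpha,h)=1$, and let $\beta$ be either $0$ or a positive integer with $(\beta,k)=1$. Then $$4hk\mu\Big(T_{\alpha,\beta}(h,k\mid\mu)+T_{\beta,\alpha}(k,h\mid\mu)\Big)=-\mu^2\sec^2\!\left(\mu\Big(\frac{\alpha}{h}+\frac{\beta}{k}\Big)\pi\right)+hk\mu+hk\sum_{j=1}^{\mu}\tan\!\left(k\Big(\frac{j}{\mu}+\frac{\alpha}{h}\Big)\pi\right)\tan\!\left(h\Big(\frac{j}{\mu}+\frac{\beta}{k}\Big)\pi\right).$$
   Context: For positive integers $\mu,h,k$ and integers $\alpha,\beta$, define $$T_{\alpha,\beta}(h,k\mid\mu)=\frac{1}{4k}\sum_{j=1}^{k-1}\tan\!\left(\mu\Big(\frac jk+\frac{\alpha}{h}+\frac{\beta}{k}\Big)\pi\right)\cot\!\left(\frac{jh}{k}\pi\right).$$ Thus $T_{\beta,\alpha}(k,h\mid\mu)=\frac{1}{4h}\sum_{j=1}^{h-1}\tan\!\left(\mu\big(\frac jh+\frac{\beta}{k}+\frac{\alpha}{h}\big)\pi\right)\cot\!\left(\frac{jk}{h}\pi\right)$. *)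

(* Defs.v *)
From mathcomp Require Import all_boot all_order all_algebra.
From mathcomp Require Import reals trigo.

Set Implicit Arguments.
Unset Strict Implicit.
Unset Printing Implicit Defensive.

Import Order.TTheory GRing.Theory Num.Theory.
Local Open Scope ring_scope.

Definition cot (R : realType) (x : R) : R := cos x / sin x.

Definition sec (R : realType) (x : R) : R := (cos x)^-1.

(* T_{alpha,beta}(h, k | mu) *)
Definition Tsum (R : realType) (alpha beta : int) (h k mu : nat) : R :=
  (4 * k%:R)^-1 *
  \sum_(1 <= j < k)
    tan (mu%:R * (j%:R / k%:R + alpha%:~R / h%:R + beta%:~R / k%:R) * pi) *
    cot ((j * h)%:R / k%:R * pi).
Arguments Tsum R alpha beta h k mu : clear implicits.

(* Main.v *)
Require Import Defs.
From mathcomp Require Import all_boot all_order all_algebra.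
From mathcomp Require Import reals trigo.
From mathcomp Require Import ring.

Import Order.TTheory GRing.Theory Num.Theory.
Local Open Scope ring_scope.

(** Write [C = (alpha / h + beta / k) pi]. The multiplication formulas
    [n cot (n x) = sum_m cot (x - m pi / n)] and, for odd [n],
    [n tan (n x) = sum_l tan (x + l pi / n)] turn the two cotangent sums into
    triple sums over [l < mu], [j < k], [m < h] of [tan u * cot (u - v)] and
    [tan v * cot (v - u)], with [u = C + l pi / mu + j pi / k] and
    [v = C + l pi / mu + m pi / h]. Their total is
    [(tan u - tan v) * cot (u - v) = 1 + tan u * tan v], except at [j = m = 0]
    where it is [0 = 1 + tan u * tan v - sec^2 u]. Summing back, the [1]s give
    [h k mu], the products factor by the tangent formula, and the [sec^2] terms
    add up to [mu^2 sec^2 (mu C)]. *)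

Section Trigonometry.
Variable R : realType.
Implicit Types (x y : R) (n : nat).

(** * Shifts by multiples of pi, and zeros of sine and cosine *)

Lemma sinDnpi n x : sin (x + n%:R * pi) = (-1) ^+ n * sin x.
Proof. by rewrite mulr_natl (alternatingn (@sinDpi R)). Qed.

Lemma cosDnpi n x : cos (x + n%:R * pi) = (-1) ^+ n * cos x.
Proof. by rewrite mulr_natl (alternatingn (@cosDpi R)). Qed.

Lemma tanDnpi n x : tan (x + n%:R * pi) = tan x.
Proof. by rewrite mulr_natl; apply: periodicn => y; exact: tanDpi. Qed.

Lemma cotN x : cot (- x) = - cot x.
Proof. by rewrite /cot cosN sinN invrN mulrN. Qed.

(* The pole of [cot] is filled in with [1 / 0 = 0]. *)
Lemma cot0 : cot 0 = 0 :> R.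
Proof. by rewrite /cot sin0 invr0 mulr0. Qed.

Lemma sin_mull_eq0 n x : sin x = 0 -> sin (n%:R * x) = 0.
Proof.
move=> sx0; elim: n => [|n IHn]; first by rewrite mul0r sin0.
by rewrite -natr1 mulrDl mul1r sinD IHn sx0 mul0r mulr0 addr0.
Qed.

(** For odd [n], [n x] is [x] plus a multiple of [2 x], and [sin (2 x)] carries the factor
    [cos x]. *)
Lemma cos_mull_eq0 n x : odd n -> cos x = 0 -> cos (n%:R * x) = 0.
Proof.
move=> n_odd cx0; rewrite -(odd_double_half n) n_odd natrD mulrDl mul1r cosD.
have -> : n./2.*2%:R * x = n./2%:R * (x *+ 2) by rewrite -muln2 natrM mulr2n; ring.
rewrite cx0 mul0r sub0r sin_mull_eq0 ?mulr0 ?oppr0 //.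
by rewrite sin_mulr2n cx0 mul0r mul0rn.
Qed.

Lemma sin_natr_divr_pi_neq0 n (a : nat) :
  (0 < n)%N -> ~~ (n %| a)%N -> sin (a%:R / n%:R * pi : R) != 0.
Proof.
move=> n_gt0 ndva; have n0 : n%:R != 0 :> R by rewrite pnatr_eq0 -lt0n.
have -> : a%:R / n%:R * pi = (a %% n)%N%:R / n%:R * pi + (a %/ n)%N%:R * pi :> R.
  by rewrite {1}(divn_eq a n) natrD natrM; field.
rewrite sinDnpi mulf_neq0 ?signr_eq0 // gt_eqF // sin_gt0_pi //.
have npos : 0 < n%:R :> R by rewrite ltr0n.
have r_gt0 : (0 < a %% n)%N by rewrite lt0n.
apply/andP; split; first by rewrite mulr_gt0 ?pi_gt0 ?divr_gt0 ?ltr0n.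
by rewrite gtr_pMl ?pi_gt0 // ltr_pdivrMr // mul1r ltr_nat ltn_mod.
Qed.

Lemma sin_mull_coprime_neq0 (h k j : nat) : coprime h k -> (0 < j < k)%N ->
  sin (h%:R * (j%:R / k%:R * pi) : R) != 0.
Proof.
move=> hk /andP[j_gt0 j_lt]; rewrite !mulrA -natrM.
rewrite sin_natr_divr_pi_neq0 ?(leq_ltn_trans _ j_lt) //.
by rewrite Gauss_dvdr 1?coprime_sym // gtnNdvd.
Qed.

(** * The multiplication formula for the cotangent *)

Lemma sum_sin_root_of_unity n (i : nat) x : (0 < i < n)%N ->
  \sum_(j < n) sin ((2 * i)%:R * (x + j%:R / n%:R * pi)) = 0.
Proof.
move=> /andP[i_gt0 i_lt_n].
have n0 : n%:R != 0 :> R.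
  by rewrite pnatr_eq0 -lt0n (leq_trans i_gt0 (ltnW i_lt_n)).
set d : R := i%:R / n%:R * pi.
have sd0 : sin d != 0.
  by rewrite sin_natr_divr_pi_neq0 ?(leq_ltn_trans _ i_lt_n) // gtnNdvd.
(* Since [2 sin d sin t = cos (t - d) - cos (t + d)] and consecutive [t] differ by [2 d],
   multiplying by [2 sin d] makes the sum telescope. *)
pose f (j : nat) := - cos ((2 * i)%:R * x + (2 * j)%:R * d - d).
have step j : 2 * sin d * sin ((2 * i)%:R * (x + j%:R / n%:R * pi)) = f j.+1 - f j.
  have -> : (2 * i)%:R * (x + j%:R / n%:R * pi) = (2 * i)%:R * x + (2 * j)%:R * d.
    by rewrite /d !natrM; field.
  rewrite /f.
  have -> : (2 * i)%:R * x + (2 * j.+1)%:R * d - d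
            = ((2 * i)%:R * x + (2 * j)%:R * d) + d by rewrite !natrM -natr1; ring.
  by rewrite cosB cosD; ring.
have c0 : 2 * sin d != 0 by rewrite mulf_neq0 ?pnatr_eq0.
apply: (mulfI c0); rewrite mulr0 mulr_sumr.
rewrite (eq_bigr (fun j : 'I_n => f j.+1 - f j)) => [|j _]; last exact: step.
rewrite -(big_mkord xpredT (fun j => f j.+1 - f j)) telescope_sumr //.
have -> : f n = f 0%N; last by rewrite subrr.
rewrite /f; congr (- _).
have -> : (2 * i)%:R * x + (2 * n)%:R * d - d
          = ((2 * i)%:R * x + (2 * 0)%:R * d - d) + (2 * i)%:R * pi.
  by rewrite /d !natrM; field.
by rewrite cosDnpi exprM sqrrN !expr1n mul1r.
Qed.

(** Induction step, with [y = 2 n x]: [cos y - cos (y + 2 x) = 2 sin (y + x) sin x], and [cot x]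
    turns this into [2 sin (y + x) cos x = sin y + sin (y + 2 x)]. *)
Lemma cot_mul_one_sub_cos n x : sin x != 0 ->
  cot x * (1 - cos ((2 * n)%:R * x)) =
  \sum_(i < n) (sin ((2 * i)%:R * x) + sin ((2 * i.+1)%:R * x)).
Proof.
move=> sx0; elim: n => [|n IHn].
  by rewrite big_ord0 muln0 mul0r cos0 subrr mulr0.
rewrite big_ord_recr /= -IHn.
have -> : (2 * n.+1)%:R * x = (2 * n)%:R * x + x + x by rewrite !natrM -natr1; ring.
move: ((2 * n)%:R * x) => y.
rewrite /cot !(cosD, sinD); have c2 := cos2sin2 x.
by field: c2.
Qed.

Lemma sin_shift_neq0 n (j : nat) x :
  sin (n%:R * x) != 0 -> sin (x + j%:R / n%:R * pi) != 0.
Proof.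
move=> snx; apply: contraNneq snx => /(@sin_mull_eq0 n).
have [->|n0] := eqVneq (n%:R : R) 0; first by rewrite !mul0r sin0.
have -> : n%:R * (x + j%:R / n%:R * pi) = n%:R * x + j%:R * pi by field.
by rewrite sinDnpi => /eqP; rewrite mulf_eq0 signr_eq0.
Qed.

(* [1 - cos (2 n t)] is the same at all the points [t = x + j pi / n], and of the
   sines in [cot_mul_one_sub_cos] only [sin (2 n t)] survives the sum over [j]. *)
Lemma sum_cot n x : sin (n%:R * x) != 0 ->
  \sum_(j < n) cot (x + j%:R / n%:R * pi) = n%:R * cot (n%:R * x).
Proof.
case: n => [|n']; first by rewrite mul0r sin0 eqxx.
set n := n'.+1 => snx.
have n0 : n%:R != 0 :> R by rewrite pnatr_eq0.
have cosE : 1 - cos ((2 * n)%:R * x) = 2 * sin (n%:R * x) ^+ 2.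
  have -> : (2 * n)%:R * x = (n%:R * x) *+ 2 by rewrite natrM mulr2n; ring.
  by rewrite cos_mulr2n sin2cos2 mulr2n; ring.
have sin2E : sin ((2 * n)%:R * x) = 2 * (cos (n%:R * x) * sin (n%:R * x)).
  have -> : (2 * n)%:R * x = (n%:R * x) *+ 2 by rewrite natrM mulr2n; ring.
  by rewrite sin_mulr2n -mulr_natl.
have shiftE (j : nat) :
    (2 * n)%:R * (x + j%:R / n%:R * pi) = (2 * n)%:R * x + (2 * j)%:R * pi.
  by rewrite !natrM; field.
have sign2 (j : nat) : (-1) ^+ (2 * j) = 1 :> R.
  by rewrite exprM sqrrN !expr1n.
have c0 : 2 * sin (n%:R * x) ^+ 2 != 0 by rewrite mulf_neq0 ?expf_neq0 ?pnatr_eq0.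
apply: (mulIf c0); rewrite mulr_suml.
under eq_bigr => j _.
  have := @cot_mul_one_sub_cos n _ (sin_shift_neq0 n j x snx).
  rewrite shiftE cosDnpi sign2 mul1r cosE => ->.
  over.
rewrite exchange_big /=.
have sum_i (i : nat) : (i < n)%N ->
    \sum_(j < n) sin ((2 * i)%:R * (x + j%:R / n%:R * pi)) = 0.
  case: i => [_|i i_lt]; last by rewrite sum_sin_root_of_unity.
  by rewrite big1 // => j _; rewrite mul0r sin0.
(* The last index is split off because its second sine has frequency [2 n], which [sum_i] does not
   reach. *)
rewrite big_ord_recr /= !big_split /= big1 => [|i _]; last first.
  by rewrite big_split /= !sum_i ?addr0 /n ?ltnS // ltnW.
rewrite sum_i // add0r add0r.
under eq_bigr => j _ do rewrite shiftE sinDnpi sign2 mul1r.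
rewrite sumr_const card_ord sin2E -mulr_natl /cot.
by field.
Qed.

(** The term at [0] vanishes by convention; the reflection [j -> n - j] reverses the sign of the
    others. *)
Lemma sum_cot0 n : \sum_(j < n) cot (j%:R / n%:R * pi) = 0 :> R.
Proof.
case: n => [|n]; first by rewrite big_ord0.
rewrite big_ord_recl /= mul0r mul0r cot0 add0r.
set S := (X in X = 0); suff: S = - S by move/eqP; rewrite eq_sym eqNr => /eqP.
rewrite {1}/S (reindex_inj rev_ord_inj) /= -sumrN; apply: eq_bigr => j _.
have -> : bump 0 (n - j.+1) = (n.+1 - bump 0 j)%N.
  by rewrite /bump /= !add1n subSS -subSn ?ltn_ord.
have : (bump 0 j <= n.+1)%N by rewrite /bump /= add1n leqW.
move: (bump 0 j) => i i_le; rewrite natrB //.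
have -> : (n.+1%:R - i%:R) / n.+1%:R * pi = - (i%:R / n.+1%:R * pi) + pi :> R.
  by field; rewrite nat1r pnatr_eq0.
by rewrite -cotN /cot cosDpi sinDpi divrNN.
Qed.

(* At [x = 0] the identity holds thanks to the convention [cot 0 = 0]. *)
Lemma sum_cotB n x : sin (n%:R * x) != 0 \/ x = 0 ->
  \sum_(j < n) cot (x - j%:R / n%:R * pi) = n%:R * cot (n%:R * x).
Proof.
move=> xP; under eq_bigr => j _ do rewrite -opprB cotN addrC.
rewrite sumrN; case: xP => [snx|->].
  by rewrite sum_cot mulrN ?cotN ?mulrN ?opprK // sinN oppr_eq0.
under eq_bigr => j _ do rewrite oppr0 add0r.
by rewrite sum_cot0 mulr0 cot0 mulr0 oppr0.
Qed.

(** * Sums of tangents and of squared secants over points spaced by [pi / n] *)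

Lemma cos_mull_neq0 n x : odd n -> cos (n%:R * x) != 0 -> cos x != 0.
Proof. by move=> n_odd; apply: contraNneq => /(cos_mull_eq0 n x n_odd) ->. Qed.

Lemma cos_shift_neq0 n (j : nat) x : odd n ->
  cos (n%:R * x) != 0 -> cos (x + j%:R / n%:R * pi) != 0.
Proof.
move=> n_odd cnx; apply: (cos_mull_neq0 n _ n_odd).
have n0 : n%:R != 0 :> R by rewrite pnatr_eq0 -lt0n odd_gt0.
have -> : n%:R * (x + j%:R / n%:R * pi) = n%:R * x + j%:R * pi by field.
by rewrite cosDnpi mulf_neq0 ?signr_eq0.
Qed.

Lemma tanE_cot x : tan x = - cot (x + pi / 2).
Proof. by rewrite /cot cosDpihalf sinDpihalf mulNr opprK. Qed.

(** This is [sum_cot] at [x + pi / 2]: for odd [n], [n (x + pi / 2)] is [n x + pi / 2] up to a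
    multiple of pi, so the right side is again a tangent. *)
Lemma sum_tan n x : odd n -> cos (n%:R * x) != 0 ->
  \sum_(j < n) tan (x + j%:R / n%:R * pi) = n%:R * tan (n%:R * x).
Proof.
move=> n_odd cnx.
under eq_bigr => j _ do rewrite tanE_cot addrAC.
have nE : n%:R * (x + pi / 2) = n%:R * x + pi / 2 + n./2%:R * pi.
  have -> : n%:R = 1 + n./2%:R * 2 :> R.
    by rewrite -[in LHS](odd_double_half n) n_odd natrD -muln2 natrM.
  by field.
have snx : sin (n%:R * (x + pi / 2)) != 0.
  by rewrite nE sinDnpi sinDpihalf mulf_neq0 ?signr_eq0.
rewrite sumrN sum_cot // -mulrN tanE_cot nE /cot cosDnpi sinDnpi.
by rewrite -mulf_div divff ?mul1r ?signr_eq0.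
Qed.

Lemma tanB_mul_cot x y : cos x != 0 -> cos y != 0 -> sin (x - y) != 0 ->
  (tan x - tan y) * cot (x - y) = 1 + tan x * tan y.
Proof.
move=> cx cy; rewrite /cot /tan cosB sinB => sxy.
by field; rewrite cx cy sxy.
Qed.

(* Expand the square of [sum_tan]: the products of tangents at points differing
   by [m pi / n], [0 < m < n], sum to [- n] by [tanB_mul_cot] and invariance of
   [sum_tan] under the shift. *)
Lemma sum_sec2 n x : odd n -> cos (n%:R * x) != 0 ->
  \sum_(j < n) sec (x + j%:R / n%:R * pi) ^+ 2 = n%:R ^+ 2 * sec (n%:R * x) ^+ 2.
Proof.
move=> n_odd cnx.
have n_gt0 := odd_gt0 n_odd.
have n0 : n%:R != 0 :> R by rewrite pnatr_eq0 -lt0n.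
pose u (j : nat) := x + j%:R / n%:R * pi.
have nu (j : nat) : n%:R * u j = n%:R * x + j%:R * pi by rewrite /u; field.
have cu (j : nat) : cos (n%:R * u j) != 0.
  by rewrite nu cosDnpi mulf_neq0 ?signr_eq0.
have sum_u (m : nat) :
    \sum_(j < n) tan (u m + j%:R / n%:R * pi) = n%:R * tan (n%:R * x).
  by rewrite sum_tan ?cu // nu tanDnpi.
have offdiag (m : nat) : (0 < m < n)%N ->
    \sum_(j < n) tan (u j) * tan (u j + m%:R / n%:R * pi) = - n%:R.
  move=> /andP[m_gt0 m_lt]; set d := m%:R / n%:R * pi.
  have sd0 : sin d != 0 by rewrite sin_natr_divr_pi_neq0 // gtnNdvd.
  have step (j : 'I_n) : tan (u j) * tan (u j + d)
      = (tan (u m + j%:R / n%:R * pi) - tan (u 0%N + j%:R / n%:R * pi)) * cot d - 1.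
    have -> : u m + j%:R / n%:R * pi = u j + d by rewrite /u /d; ring.
    have -> : u 0%N + j%:R / n%:R * pi = u j by rewrite /u; ring.
    have dE : u j + d - u j = d by ring.
    rewrite -[in cot d]dE tanB_mul_cot ?dE //; first by ring.
      by rewrite cos_shift_neq0 ?cu.
    exact: cos_shift_neq0.
  under eq_bigr => j _ do rewrite step.
  rewrite big_split /= -mulr_suml sumrB !sum_u subrr mul0r add0r.
  by rewrite sumr_const card_ord mulNrn.
have sumsq : \sum_(m < n) \sum_(j < n) tan (u j) * tan (u j + m%:R / n%:R * pi)
    = (n%:R * tan (n%:R * x)) ^+ 2.
  rewrite exchange_big /=.
  under eq_bigr => j _ do rewrite -mulr_sumr sum_u.
  by rewrite -mulr_suml sum_tan // expr2.
have secE (y : R) : cos y != 0 -> sec y ^+ 2 = 1 + tan y * tan y.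
  by move=> cy; rewrite /sec exprVn cos2_tan2 // expr2.
under eq_bigr => j _ do rewrite secE ?cos_shift_neq0 //.
rewrite secE // -expr2 mulrDr mulr1 -exprMn -sumsq big_split /=.
rewrite sumr_const card_ord.
(* The term [m = 0] is the sum of the squared tangents; the [n - 1] others total [- n (n - 1)],
   which reduces [n ^ 2] to the [n] on the left. *)
rewrite [in RHS](bigD1 (Ordinal n_gt0)) //= [X in _ + (_ + X)](eq_bigr (fun=> - n%:R)).
  rewrite sumr_const cardC1 card_ord mulNrn -[n%:R *+ n.-1]mulr_natr -subn1 natrB //.
  under [X in _ = _ + (X + _)]eq_bigr => j _ do rewrite mul0r mul0r addr0.
  by ring.
by move=> m m0; apply: offdiag; rewrite ltn_ord lt0n andbT.
Qed.

(** Keeps the tangents away from their poles: the angles to be met are rational multiples of pi with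
    odd denominators. *)
Lemma cos_natr_divr_pi_neq0 n (a : nat) : odd n -> cos (a%:R / n%:R * pi : R) != 0.
Proof.
move=> n_odd; have n0 : n%:R != 0 :> R by rewrite pnatr_eq0 -lt0n odd_gt0.
apply: (cos_mull_neq0 n _ n_odd).
have -> : n%:R * (a%:R / n%:R * pi) = 0 + a%:R * pi :> R by field.
by rewrite cosDnpi cos0 mulr1 signr_eq0.
Qed.

(** * Expansion into triple sums, and their total *)

Lemma sum_indicator0 n : (0 < n)%N -> \sum_(j < n) (j == 0 :> nat)%:R = 1 :> R.
Proof.
by case: n => // n _; rewrite big_ord_recl /= big1 ?addr0.
Qed.

Lemma Tsum_expand (h k mu alpha beta : nat) :
  odd h -> odd k -> odd mu -> coprime h k ->
  let C := (alpha%:R / h%:R + beta%:R / k%:R) * pi in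
  4 * h%:R * k%:R * mu%:R * Tsum R alpha%:Z beta%:Z h k mu =
  \sum_(l < mu) \sum_(j < k) \sum_(m < h)
    tan (C + l%:R / mu%:R * pi + j%:R / k%:R * pi) *
    cot (j%:R / k%:R * pi - m%:R / h%:R * pi).
Proof.
move=> h_odd k_odd mu_odd hk C.
have h0 : h%:R != 0 :> R by rewrite pnatr_eq0 -lt0n odd_gt0.
have k0 : k%:R != 0 :> R by rewrite pnatr_eq0 -lt0n odd_gt0.
have mu0 : mu%:R != 0 :> R by rewrite pnatr_eq0 -lt0n odd_gt0.
rewrite /Tsum -!pmulrn.
pose F (j : nat) : R :=
  tan (mu%:R * (j%:R / k%:R + alpha%:R / h%:R + beta%:R / k%:R) * pi) *
  cot ((j * h)%:R / k%:R * pi).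
have -> : \sum_(1 <= j < k) F j = \sum_(j < k) F j.
  rewrite -(big_mkord xpredT F) [RHS]big_ltn ?odd_gt0 //.
  by rewrite {2}/F !mul0r cot0 mulr0 add0r.
have -> : 4 * h%:R * k%:R * mu%:R * ((4 * k%:R)^-1 * \sum_(j < k) F j)
    = h%:R * mu%:R * \sum_(j < k) F j.
  by field.
rewrite mulr_sumr [RHS]exchange_big; apply: eq_bigr => j _ /=.
have cC : cos (mu%:R * (C + j%:R / k%:R * pi)) != 0.
  have -> : mu%:R * (C + j%:R / k%:R * pi)
      = (mu * (alpha * k + beta * h + j * h))%:R / (h * k)%:R * pi.
    by rewrite /C !(natrM, natrD); field; rewrite h0 k0.
  by rewrite cos_natr_divr_pi_neq0 // oddM h_odd.
(* The two cases of [sum_cotB]; the added index [j = 0] falls under the second. *)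
have sj : sin (h%:R * (j%:R / k%:R * pi) : R) != 0 \/ j%:R / k%:R * pi = 0 :> R.
  have [j0|j_gt0] := posnP j; first by right; rewrite j0 !mul0r.
  by left; rewrite sin_mull_coprime_neq0 // j_gt0 ltn_ord.
under eq_bigr => l _.
  rewrite -mulr_sumr sum_cotB // addrAC.
  over.
rewrite -mulr_suml sum_tan // /F /C.
have -> : (j * h)%:R / k%:R * pi = h%:R * (j%:R / k%:R * pi) :> R by rewrite natrM; ring.
have -> : mu%:R * (j%:R / k%:R + alpha%:R / h%:R + beta%:R / k%:R) * pi
  = mu%:R * ((alpha%:R / h%:R + beta%:R / k%:R) * pi + j%:R / k%:R * pi) :> R by ring.
by ring.
Qed.

Lemma sum_tanB_mul_cot (h k : nat) x :
  odd h -> odd k -> coprime h k -> cos (h%:R * x) != 0 -> cos (k%:R * x) != 0 ->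
  \sum_(j < k) \sum_(m < h)
    (tan (x + j%:R / k%:R * pi) - tan (x + m%:R / h%:R * pi)) *
    cot (j%:R / k%:R * pi - m%:R / h%:R * pi) =
  h%:R * k%:R + h%:R * k%:R * (tan (k%:R * x) * tan (h%:R * x)) - sec x ^+ 2.
Proof.
move=> h_odd k_odd hk chx ckx.
have h0 : h%:R != 0 :> R by rewrite pnatr_eq0 -lt0n odd_gt0.
have k0 : k%:R != 0 :> R by rewrite pnatr_eq0 -lt0n odd_gt0.
have term (j : 'I_k) (m : 'I_h) :
    (tan (x + j%:R / k%:R * pi) - tan (x + m%:R / h%:R * pi)) *
    cot (j%:R / k%:R * pi - m%:R / h%:R * pi) =
    1 + tan (x + j%:R / k%:R * pi) * tan (x + m%:R / h%:R * pi)
    (* The correction at [j = m = 0] is a product of two indicators, so that each can be summed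
       separately. *)
    - (j == 0 :> nat)%:R * ((m == 0 :> nat)%:R * sec x ^+ 2).
  have [|jm] := boolP ((j == 0 :> nat) && (m == 0 :> nat)).
    move=> /andP[/eqP -> /eqP ->]; rewrite !mul0r !addr0 !subrr mul0r !mul1r.
    by rewrite /sec exprVn cos2_tan2 ?expr2 ?subrr // (cos_mull_neq0 h).
  have -> : (j == 0 :> nat)%:R * ((m == 0 :> nat)%:R * sec x ^+ 2) = 0 :> R.
    by rewrite mulrA -natrM mulnb (negPf jm) mul0r.
  have dE : j%:R / k%:R * pi - m%:R / h%:R * pi
      = (x + j%:R / k%:R * pi) - (x + m%:R / h%:R * pi) by ring.
  rewrite dE tanB_mul_cot ?subr0 ?cos_shift_neq0 // -dE.
  have [j0|j_gt0] := posnP j.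
    rewrite j0 !mul0r sub0r sinN oppr_eq0 sin_natr_divr_pi_neq0 ?odd_gt0 //.
    by rewrite gtnNdvd // lt0n; move: jm; rewrite j0.
  (* If the sine of the difference vanished, so would the sine of [h] times it, which is
     [sin (h j pi / k)] up to sign; coprimality forbids this. *)
  have sjh : sin (h%:R * (j%:R / k%:R * pi) : R) != 0.
    by rewrite sin_mull_coprime_neq0 // j_gt0 ltn_ord.
  rewrite -oppr_eq0 -sinN opprB addrC sin_shift_neq0 //.
  by rewrite mulrN sinN oppr_eq0.
under eq_bigr => j _ do (under eq_bigr => m _ do rewrite term).
under eq_bigr => j _.
  rewrite big_split big_split /= sumr_const card_ord -mulr_sumr.
  rewrite sumrN -mulr_sumr -mulr_suml sum_tan // sum_indicator0 ?odd_gt0 // mul1r.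
  over.
rewrite big_split big_split /= sumr_const card_ord sumrN -!mulr_suml.
rewrite sum_tan // sum_indicator0 ?odd_gt0 // mul1r -[h%:R *+ k]mulr_natr.
by ring.
Qed.

End Trigonometry.

Theorem mainTheorem13 (R : realType) (h k mu alpha beta : nat)
  (hodd : odd h) (kodd : odd k) (muodd : odd mu)
  (hk : coprime h k) (hmu : coprime h mu) (kmu : coprime k mu)
  (h3 : (3 <= h)%N) (k3 : (3 <= k)%N)
  (halpha : alpha = 0%N \/ (0 < alpha)%N /\ coprime alpha h)
  (hbeta : beta = 0%N \/ (0 < beta)%N /\ coprime beta k) :
  4 * h%:R * k%:R * mu%:R *
    (Tsum R alpha%:Z beta%:Z h k mu + Tsum R beta%:Z alpha%:Z k h mu) =
  - mu%:R ^+ 2 * sec (mu%:R * (alpha%:R / h%:R + beta%:R / k%:R) * pi) ^+ 2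
  + h%:R * k%:R * mu%:R
  + h%:R * k%:R *
    \sum_(1 <= j < mu.+1)
      tan (k%:R * (j%:R / mu%:R + alpha%:R / h%:R) * pi) *
      tan (h%:R * (j%:R / mu%:R + beta%:R / k%:R) * pi).
Proof.
have h0 : h%:R != 0 :> R by rewrite pnatr_eq0 -lt0n odd_gt0.
have k0 : k%:R != 0 :> R by rewrite pnatr_eq0 -lt0n odd_gt0.
have mu0 : mu%:R != 0 :> R by rewrite pnatr_eq0 -lt0n odd_gt0.
pose C : R := (alpha%:R / h%:R + beta%:R / k%:R) * pi.
pose x (l : nat) := C + l%:R / mu%:R * pi.
have cx n l : cos (n%:R * x l) != 0.
  have -> : n%:R * x l
      = (n * (alpha * k * mu + beta * h * mu + l * (h * k)))%:R / (h * k * mu)%:R * pi.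
    by rewrite /x /C !(natrM, natrD); field; rewrite h0 k0 mu0.
  by rewrite cos_natr_divr_pi_neq0 // !oddM hodd kodd.
(* Multiplying by [k] turns [beta pi / k] into [beta pi], a period of [tan]. *)
have kx l : tan (k%:R * x l) = tan (k%:R * (l%:R / mu%:R + alpha%:R / h%:R) * pi).
  rewrite -[RHS](tanDnpi _ beta); congr tan.
  by rewrite /x /C; field; rewrite h0 k0 mu0.
have hx l : tan (h%:R * x l) = tan (h%:R * (l%:R / mu%:R + beta%:R / k%:R) * pi).
  rewrite -[RHS](tanDnpi _ alpha); congr tan.
  by rewrite /x /C; field; rewrite h0 k0 mu0.
pose G (l : nat) : R := tan (k%:R * (l%:R / mu%:R + alpha%:R / h%:R) * pi) *
      tan (h%:R * (l%:R / mu%:R + beta%:R / k%:R) * pi).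
(* The index [mu] can be traded for [0]: [x mu] and [x 0] differ by pi. *)
have -> : \sum_(1 <= j < mu.+1) G j = \sum_(l < mu) G l.
  rewrite -(big_mkord xpredT G) big_nat_recr ?odd_gt0 //= [RHS]big_ltn ?odd_gt0 //.
  rewrite addrC; congr (_ + _); rewrite /G -!kx -!hx.
  have -> : k%:R * x mu = k%:R * x 0%N + k%:R * pi by rewrite /x; field.
  have -> : h%:R * x mu = h%:R * x 0%N + h%:R * pi by rewrite /x; field.
  by rewrite !tanDnpi.
rewrite mulrDr Tsum_expand // -/C.
have -> : 4 * h%:R * k%:R * mu%:R = 4 * k%:R * h%:R * mu%:R :> R by ring.
rewrite Tsum_expand 1?coprime_sym // [beta%:R / _ + _]addrC -/C -big_split /=.
have inner (l : 'I_mu) : true ->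
    \sum_(j < k) \sum_(m < h)
       tan (C + l%:R / mu%:R * pi + j%:R / k%:R * pi) *
       cot (j%:R / k%:R * pi - m%:R / h%:R * pi) +
    \sum_(m < h) \sum_(j < k)
       tan (C + l%:R / mu%:R * pi + m%:R / h%:R * pi) *
       cot (m%:R / h%:R * pi - j%:R / k%:R * pi) =
    h%:R * k%:R + h%:R * k%:R * G l - sec (x l) ^+ 2.
  (* Once both sums run in the same order, oddness of [cot] merges the terms into
     [(tan u - tan v) * cot (u - v)]. *)
  move=> _; rewrite [X in _ + X]exchange_big /= -big_split /= /G -kx -hx.
  rewrite -sum_tanB_mul_cot //; apply: eq_bigr => j _.
  rewrite -big_split /=; apply: eq_bigr => m _.
  by rewrite -[m%:R / _ * pi - _]opprB cotN /x; ring.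
rewrite (eq_bigr _ inner) big_split big_split /= sumrN sumr_const card_ord -mulr_sumr.
rewrite sum_sec2 //; last by have := cx mu 0%N; rewrite /x !mul0r addr0.
by rewrite /C [mu%:R * (_ * pi)]mulrA -[_ * _ *+ mu]mulr_natr; ring.
Qed.
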